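(* Let $p$ be a prime, let $G$ be a finite $p$-group, and let $S$ be a Sylow $p$-subgroup of $\operatorname{Aut}(G)$ with $\exp(S)=q$. Then: (i) If $G$ is a metabelian $p$-group of nilpotency class at most $2p-1$, then $\exp(G)$ divides $pq^3$. (ii) If the nilpotency class of $G$ is $c$, then $\exp(G)$ divides $p^{\lceil \log_p c\rceil}q^3$.
   Context: $\exp(H)$ denotes the exponent of a finite group $H$, i.e. the least positive integer $e$ with $h^e=1$ for all $h\in H$. $\operatorname{Aut}(G)$ is the automorphism group of $G$. A group is metabelian if its commutator subgroup is abelian. $\lceil\cdot\rceil$ is the ceiling function.
   Formalization: In (ii) the groups G of order p are excluded: for them c = 1 and Aut(G) has order p − 1, so q = 1 and the claimed bound is 1, although exp(G) = p. *)

(* Defs.v *)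
From mathcomp Require Import all_boot fingroup.

Set Implicit Arguments.
Unset Strict Implicit.
Unset Printing Implicit Defensive.

Definition metabelian (gT : finGroupType) (G : {set gT}) : bool :=
  abelian [~: G, G]%g.

(* In the main statement the ceiling of the base-p logarithm of c is
   [up_log p c], the least e with c <= p ^ e; [up_log p 0 = 0] is reached only
   for the trivial group, the only group of class 0.
   The bound p ^ (up_log p c) * q ^ 3 fails for a group G of order p: then
   c = 1 and Aut G has order p - 1, so that q = 1 and the bound is 1, whereas
   G has exponent p. Hence the hypothesis #|G| != p on that bound. *)

(* Main.v *)
Require Import Defs.
From mathcomp Require Import all_boot fingroup perm automorphism.
From mathcomp Require Import morphism quotient gproduct.
From mathcomp Require Import cyclic center commutator.
From mathcomp Require Import pgroup nilpotent abelian sylow.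

(** Write q for exp(S) and Z for the centre of G. Inner automorphisms are
    p-elements of Aut(G), so x^q is central for every x in G; hence exp(G)
    divides q exp(Z). Central automorphisms supply the rest: if t in Z and f is
    a homomorphism from G onto <t> with f(t) in <t^(p^2)>, then x |-> x f(x) is
    an automorphism, its N-th power is x |-> x f(x)^(1 + (1+a) + ... +
    (1+a)^(N-1)) where f(t) = t^a, and since p^2 divides a the exponent has the
    same p-adic valuation as N. So the order of t divides q
    ([order_central_aut]). Such f come from the cyclic quotients of G/G'; they
    yield the dichotomy [exponent_center_or_der1]:

    - either exp(Z) divides p^2 q, and exp(G) divides q exp(Z);
    - or exp(G/G') divides p q, and exp(G) divides exp(G/G') exp(G').

    The same lemma shows that p divides q as soon as |G| > p. In the first
    case both bounds follow at once. In the second one it remains to bound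
    exp(G') by q times p^l with p^l >= c in general ([exponent_lcn]), and by p q
    when G is metabelian of class at most p^2 ([exponent_der1_metabelian]); note
    that 2p - 1 <= p^2.

    These two bounds compare [x^N, y] = 1 (for N divisible by q) with [x, y]^N,
    and (ab)^N with a^N b^N. The comparison is a form of the Hall-Petrescu
    formula: a polynomial sequence g with g(0) = 1 can be written as
    g(N) = g(1)^N a_2^C(N,2) a_3^C(N,3) ..., with a_j deep in the lower central
    series ([polyseq_Taylor]). The sequences N |-> x^N are polynomial, and
    polynomial sequences are closed under products, inverses and commutators
    ([jetP], after Lazard and Leibman), so no collection process is needed. As
    C(p^e, j) is divisible by p^(e - v_p(j)) and a_j lies deeper when j is
    larger, a descending induction along the series kills all the correction
    factors. *)

Set Implicit Arguments.
Unset Strict Implicit.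
Unset Printing Implicit Defensive.

(** * Divisibility of geometric sums and of binomial coefficients *)

(** The sum of the powers b^i for i < N has the p-adic valuation of N when
    b = 1 mod p^2. It is congruent to N mod p, which settles N prime to p; for
    N = p M it is the sum of length M times the sum of p powers of b^M, and the
    latter is congruent to p mod p^2. Working modulo p^2 rather than p makes
    p = 2 no exception. *)
Lemma dvdn_geometric_sum p a r N : prime p -> p ^ 2 %| a -> 0 < N ->
  p ^ r %| \sum_(i < N) a.+1 ^ i -> p ^ r %| N.
Proof.
move=> pr_p; case: a => [_ _|a pa].
  by under eq_bigr do rewrite exp1n; rewrite sum_nat_const card_ord muln1.
have p_gt0 := prime_gt0 pr_p.
have modb d M : d %| p ^ 2 -> a.+2 ^ M = 1 %[mod d].
  move=> d_p; rewrite -modnXm -addn1 -modnDml (eqP (dvdn_trans d_p pa)).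
  by rewrite modnXm exp1n.
have sumE c d M : c = 1 %[mod d] -> \sum_(i < M) c ^ i = M %[mod d].
  move=> c1; elim: M => [|M IHM]; first by rewrite big_ord0.
  rewrite big_ord_recr /= -modnDm IHM -(modnXm M d c) c1 modnXm exp1n.
  by rewrite modnDm addn1.
have [k] := ubnP N; elim: k => // k IHk in r N *; rewrite ltnS => leNk N_gt0.
case: r => [|r]; first by rewrite dvd1n.
have [/dvdnP[M def_N] | pN] := boolP (p %| N); last first.
  move=> /(dvdn_trans (dvdn_exp (ltn0Sn r) (dvdnn p))).
  rewrite /dvdn sumE -/(dvdn _ _) ?(negPf pN) //.
  by rewrite -(modb p 1) // dvdn_exp.
have M_gt0 : 0 < M by move: N_gt0; rewrite def_N muln_gt0 => /andP[].
have ->: \sum_(i < N) a.+2 ^ i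
    = (\sum_(i < M) a.+2 ^ i) * \sum_(i < p) (a.+2 ^ M) ^ i.
  apply/eqP; rewrite -(eqn_pmul2l (ltn0Sn a)) mulnA.
  by rewrite -[a.+1]/(a.+2.-1) -!predn_exp -expnM -def_N.
set u := \sum_(i < p) _ => dv.
have u_p : u = p %[mod p ^ 2] by apply/sumE/modb.
have [v def_u pv] : exists2 v, u = v * p & ~~ (p %| v).
  have /dvdnP[v def_u] : p %| u.
    rewrite /dvdn -(@modn_dvdm (p ^ 2)) ?dvdn_exp // u_p.
    by rewrite modn_dvdm ?dvdn_exp // modnn.
  exists v => //; have : v %% p * p == 1 * p.
    rewrite mul1n muln_modl mulnn -def_u u_p modn_small //.
    by rewrite -mulnn ltn_Pmull ?prime_gt1.
  by rewrite eqn_pmul2r // /dvdn => /eqP->.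
move: dv; rewrite def_u mulnA expnSr dvdn_pmul2r // => dv.
rewrite def_N dvdn_pmul2r //; apply: IHk => //.
  by apply: leq_trans leNk; rewrite def_N ltn_Pmulr ?prime_gt1.
by move: dv; rewrite Gauss_dvdl // coprimeXl // prime_coprime.
Qed.

Lemma dvdn_bin_expn p e j :
  prime p -> 0 < j -> p ^ (e - logn p j) %| 'C(p ^ e, j).
Proof.
move=> pr_p; case: j => // j _.
have [ltNj|lejN] := ltnP (p ^ e) j.+1; first by rewrite bin_small.
have C_gt0 : 0 < 'C(p ^ e, j.+1) by rewrite bin_gt0.
rewrite pfactor_dvdn // leq_subLR -lognM // -mul_bin_diag.
have N_gt0 : 0 < p ^ e by rewrite expn_gt0 prime_gt0.
by rewrite lognM ?pfactorK ?leq_addr // bin_gt0 -ltnS prednK.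
Qed.

Import GroupScope.

(** * Polynomial sequences in a filtered group *)

Section PolynomialSequences.

Variables (gT : finGroupType) (E : nat -> {group gT}) (w : nat).
Hypothesis EB : forall s t, s <= t -> E t \subset E s.
Hypothesis ER : forall s t, [~: E s, E t] \subset E (s + t).

Definition diffg (g : nat -> gT) : nat -> gT := fun k => (g k)^-1 * g k.+1.

(** [jet n m g] says that the i-th iterated difference of [g] at 0 lies in
    [E (m + w * i)] for all i <= n. The first conjunct of the successor case
    repeats the conditions of order at most n', so that every closure property
    goes through by induction on [n] with [m] varying. *)
Fixpoint jet n m (g : nat -> gT) : Prop :=
  if n is n'.+1 then jet n' m g /\ jet n' (m + w) (diffg g) else g 0 \in E m.

Lemma eq_jet n m g h : g =1 h -> jet n m g -> jet n m h.
Proof.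
elim: n m g h => [|n IHn] m g h eqgh /=; first by rewrite eqgh.
case=> jg jdg; split; [exact: IHn jg | apply: IHn jdg => k].
by rewrite /diffg !eqgh.
Qed.

Lemma jet_leq n s t g : t <= s -> jet n s g -> jet n t g.
Proof.
elim: n s t g => [|n IHn] s t g le_ts /=; first exact/subsetP/EB.
by case=> jg jdg; split; [apply: IHn jg | apply: IHn jdg; rewrite leq_add2r].
Qed.

Lemma diffgM g h k :
  diffg (fun i => g i * h i) k = diffg g k * [~ diffg g k, h k] * diffg h k.
Proof. by rewrite /diffg -conjg_mulR /conjg invMg !mulgA !mulgK. Qed.

Lemma diffgV g k :
  diffg (fun i => (g i)^-1) k = (diffg g k)^-1 * [~ (diffg g k)^-1, (g k)^-1].
Proof. by rewrite /diffg -conjg_mulR /conjg !invMg !invgK !mulgA mulgK. Qed.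

Lemma diffgR g h k (a := diffg g k) (b := diffg h k) :
  diffg (fun i => [~ g i, h i]) k =
    [~ g k * a, b] * [~ [~ g k * a, b], [~ g k, h k]] * [~ [~ g k, h k], a]
      * [~ a, h k] * [~ [~ g k * a, h k], b].
Proof.
have gS : g k.+1 = g k * a by rewrite mulKVg.
have hS : h k.+1 = h k * b by rewrite mulKVg.
rewrite {1}/diffg gS hS commgMR; set c := [~ g k * a, b].
have eE : [~ g k * a, h k] = [~ g k, h k] * [~ [~ g k, h k], a] * [~ a, h k].
  exact: commMgR.
set e := [~ g k * a, h k] in eE *; set d := [~ g k, h k] in eE *.
by rewrite {1}eE -(conjg_mulR c d) /conjg !mulgA.
Qed.

(** All closure properties have to be proved together: the difference of a
    product, an inverse or a commutator is a product of differences and of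
    commutators with differences, each of which sits at least [w] levels
    deeper, so that the induction hypotheses at order n apply to it. *)
Lemma jetP n :
  [/\ forall s g h, jet n s g -> jet n s h -> jet n s (fun i => g i * h i),
      forall s g, jet n s g -> jet n s (fun i => (g i)^-1)
    & forall s t g h, jet n s g -> jet n t h ->
        jet n (s + t) (fun i => [~ g i, h i])].
Proof.
elim: n => [|n [IHM IHV IHR]] /=.
  split=> [s g h|s g|s t g h]; [exact: groupM | by rewrite groupV |].
  by move=> gs ht; apply: (subsetP (ER s t)); apply: mem_commg.
have sub s t g : jet n s g -> t <= s -> jet n t g by move/jet_leq; apply.
split=> [s g h [jg jdg] [jh jdh] | s g [jg jdg] | s t g h [jg jdg] [jh jdh]].
- split; first exact: IHM.
  apply: eq_jet (fun k => esym (diffgM g h k)) _; apply: (IHM) jdh.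
  apply: (IHM) => //; apply: sub (IHR _ _ _ _ jdg jh) _.
  exact: leq_addr.
- split; first exact: IHV.
  apply: eq_jet (fun k => esym (diffgV g k)) _; apply: (IHM); first exact: IHV.
  apply: sub (IHR _ _ _ _ (IHV _ _ jdg) (IHV _ _ jg)) _; exact: leq_addr.
split; first exact: IHR.
have jga : jet n s (fun i => g i * diffg g i).
  by apply: (IHM) => //; apply: sub jdg _; apply: leq_addr.
have jgb := IHR _ _ _ _ jga jdh; have jgh := IHR _ _ _ _ jg jh.
apply: eq_jet (fun k => esym (diffgR g h k)) _.
apply: (IHM); [apply: (IHM); [apply: (IHM); [apply: (IHM) | ] | ] | ].
- by apply: sub jgb _; rewrite addnA.
- by apply: sub (IHR _ _ _ _ jgb jgh) _; rewrite (addnA s t w) leq_addr.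
- by apply: sub (IHR _ _ _ _ jgh jdg) _; rewrite leq_add2l leq_addl.
- by apply: sub (IHR _ _ _ _ jdg jh) _; rewrite addnAC.
- by apply: sub (IHR _ _ _ _ (IHR _ _ _ _ jga jh) jdh) _;
    rewrite leq_add2l leq_addl.
Qed.

Lemma jet1 n m : jet n m (fun=> 1).
Proof.
elim: n m => [|n IHn] m /=; first exact: group1.
split=> //; apply: eq_jet (IHn _) => k; by rewrite /diffg mulVg.
Qed.

Lemma jet_const n m x : x \in E m -> jet n m (fun=> x).
Proof.
move=> Ex; elim: n => [|n IHn] //=; split=> //.
by apply: eq_jet (jet1 _ _) => k; rewrite /diffg mulVg.
Qed.

Definition polyseq m g := forall n, jet n m g.

Lemma polyseqM m g h :
  polyseq m g -> polyseq m h -> polyseq m (fun i => g i * h i).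
Proof. by move=> pg ph n; have [jM _ _] := jetP n; apply: jM. Qed.

Lemma polyseqV m g : polyseq m g -> polyseq m (fun i => (g i)^-1).
Proof. by move=> pg n; have [_ jV _] := jetP n; apply: jV. Qed.

Lemma polyseqR s t g h :
  polyseq s g -> polyseq t h -> polyseq (s + t) (fun i => [~ g i, h i]).
Proof. by move=> pg ph n; have [_ _ jR] := jetP n; apply: jR. Qed.

Lemma polyseq_const m x : x \in E m -> polyseq m (fun=> x).
Proof. by move=> Ex n; apply: jet_const. Qed.

Lemma polyseq_bin m j x :
  x \in E (m + w * j) -> polyseq m (fun k => x ^+ 'C(k, j)).
Proof.
move=> Ex n; elim: n m j Ex => [|n IHn] m j Ex /=.
  by apply/groupX/(subsetP (EB _) _ Ex)/leq_addr.
split; first exact: IHn.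
case: j Ex => [|j] Ex.
  by apply: eq_jet (jet1 _ _) => k; rewrite /diffg !bin0 mulVg.
apply: eq_jet (IHn (m + w) j _) => [k|]; last by rewrite -addnA -mulnS.
by rewrite /diffg binS expgD mulKg.
Qed.

Lemma polyseq_expg x : x \in E w -> polyseq 0 (fun k => x ^+ k).
Proof.
move=> Ex n; apply: eq_jet (polyseq_bin (m := 0) (j := 1) _ n) => [k|].
  by rewrite bin1.
by rewrite muln1.
Qed.

(** For [g] trivial before n, [g n] is the n-th difference of [g] at 0. *)
Lemma jet_last n m g : jet n m g -> (forall k, k < n -> g k = 1) ->
  g n \in E (m + w * n).
Proof.
elim: n m g => [|n IHn] m g /=; first by rewrite muln0 addn0.
case=> _ jdg g1; rewrite mulnS addnA.
have -> : g n.+1 = diffg g n by rewrite /diffg (g1 n) // invg1 mul1g.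
by apply: IHn => // k ltkn; rewrite /diffg !g1 ?invg1 ?mul1g // ltnW.
Qed.

Lemma polyseq_prod_bin m N (a : nat -> gT) :
    (forall j, a j \in E (m + w * j)) ->
  polyseq m (fun k => \prod_(0 <= j < N) a j ^+ 'C(k, j)).
Proof.
move=> Ea; elim: N => [|N IHN] n.
  by apply: eq_jet (jet1 n m) => k; rewrite big_geq.
apply: eq_jet (polyseqM IHN (polyseq_bin (Ea N)) n) => k.
by rewrite big_nat_recr.
Qed.

(** Coefficients are found one at a time: the quotient of [g] by the product
    already built is a polynomial sequence that is trivial before N, so its
    value at N is an admissible coefficient by [jet_last], and the new factor
    does not affect earlier values because C(k, N) = 0 for k < N. *)
Lemma polyseq_Taylor m N g : polyseq m g ->
  exists2 a : nat -> gT, forall j, a j \in E (m + w * j)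
    & forall k, k < N -> g k = \prod_(0 <= j < N) a j ^+ 'C(k, j).
Proof.
move=> pg; elim: N => [|N [a Ea def_g]].
  by exists (fun=> 1) => // j; apply: group1.
pose b k := \prod_(0 <= j < N) a j ^+ 'C(k, j).
have pb : polyseq m b by apply: polyseq_prod_bin.
pose r k := (b k)^-1 * g k.
have r1 k : k < N -> r k = 1 by move=> ltkN; rewrite /r def_g // mulVg.
have Er : r N \in E (m + w * N).
  by apply: jet_last r1; apply: polyseqM pg _; apply: polyseqV.
exists (fun j => if j == N then r N else a j) => [j|k].
  by case: eqP => [->|].
rewrite ltnS big_nat_recr //= eqxx => lekN.
rewrite (eq_big_nat _ _ (F2 := fun j => a j ^+ 'C(k, j))) => [|j]; last first.
  by case/andP=> _ /ltn_eqF->.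
move: lekN; rewrite leq_eqVlt => /predU1P[->|ltkN].
  by rewrite binn /r /b mulKVg.
by rewrite bin_small // mulg1 def_g.
Qed.

Lemma polyseq_expg_eq m N g : polyseq m g -> g 0 = 1 ->
    (forall j x, 1 < j -> x \in E (m + w * j) -> x ^+ 'C(N, j) = 1) ->
  g N = g 1%N ^+ N.
Proof.
move=> pg g0 vanish; have [a Ea def_g] := polyseq_Taylor N.+2 pg.
have a0 : a 0 = 1.
  rewrite -g0 def_g // big_ltn // bin0 expg1 big_nat big1 ?mulg1 // => j.
  by case/andP=> lt0j _; rewrite bin_small.
have a1 : a 1%N = g 1%N.
  rewrite def_g // big_ltn // big_ltn // a0 expg1n mul1g binn expg1.
  rewrite big_nat big1 ?mulg1 // => j; case/andP=> lt0j _.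
  by rewrite bin_small.
rewrite def_g // big_ltn // big_ltn // a0 expg1n mul1g bin1 a1.
rewrite big_nat big1 ?mulg1 // => j /andP[lt1j _]; exact: vanish.
Qed.

End PolynomialSequences.

(** * The lower central series as a filtration *)

Section LowerCentral.

Variables (gT : finGroupType) (G : {group gT}).

(** The three subgroup lemma modulo a normalised subgroup. *)
Lemma three_subgroup_sub (A B C N : {group gT}) :
    A \subset 'N(N) -> B \subset 'N(N) -> C \subset 'N(N) ->
    [~: A, B, C] \subset N -> [~: B, C, A] \subset N ->
  [~: C, A, B] \subset N.
Proof.
move=> nA nB nC sABC sBCA.
have nR (X Y : {group gT}) : X \subset 'N(N) -> Y \subset 'N(N) ->
  [~: X, Y] \subset 'N(N).
- move=> nX nY; apply: subset_trans (commg_sub X Y) _.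
  by rewrite join_subG nX.
have quo (X Y Z : {group gT}) : X \subset 'N(N) -> Y \subset 'N(N) ->
    Z \subset 'N(N) ->
  ([~: X, Y, Z] \subset N) = ([~: X / N, Y / N, Z / N] == 1).
- by move=> nX nY nZ; rewrite -!quotientR ?nR // -quotient_sub1 ?nR ?subG1.
move: sABC sBCA; rewrite !quo // => /eqP ABC /eqP BCA.
by apply/eqP; apply: three_subgroup ABC BCA.
Qed.

(** Induction on [t], by the three subgroup lemma applied to G, L_s, L_t. *)
Lemma lcnR s t : [~: 'L_s(G), 'L_t(G)] \subset 'L_(s + t)(G).
Proof.
have nL i j : 'L_i(G) \subset 'N('L_j(G)).
  exact: subset_trans (lcn_sub _ _) (lcn_norm _ _).
elim: t s => [|t IHt] s; first by rewrite addn0 commg_subl lcn_norm.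
case: t => [|t] in IHt *; first by rewrite addn1 lcnSnS.
rewrite lcnSn commGC.
have nG j : G \subset 'N('L_j(G)) by apply: lcn_norm.
apply: (three_subgroup_sub (nG _) (nL s _) (nL t.+1 _)).
  rewrite (commGC G); apply: subset_trans (commSg _ (lcnSnS _ _)) _.
  by rewrite addnS -addSn IHt.
by rewrite addnS; apply: subset_trans (commSg _ (IHt s)) (lcnSnS _ _).
Qed.

End LowerCentral.

(** * Exponents of the terms of the lower central series *)

Section LowerCentralExponent.

Variables (gT : finGroupType) (G : {group gT}) (p n : nat).
Hypothesis pr_p : prime p.
Hypothesis expZ : forall x y, x \in G -> y \in G -> [~ x ^+ (p ^ n), y] = 1.

Let lcnB s t : s <= t -> 'L_t(G) \subset 'L_s(G).
Proof. exact: lcn_sub_leq. Qed.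

(** Hall-Petrescu for (ab)^N when all correction terms are trivial: the sequence
    b^-k a^-k (ab)^k is polynomial and is trivial at 0 and 1. *)
Lemma expg_mul_lcn i N a b : a \in 'L_i(G) -> b \in 'L_i(G) ->
    (forall j x, 1 < j -> x \in 'L_(i * j)(G) -> x ^+ 'C(N, j) = 1) ->
  (a * b) ^+ N = a ^+ N * b ^+ N.
Proof.
move=> La Lb vanish; pose g k := (b ^+ k)^-1 * (a ^+ k)^-1 * (a * b) ^+ k.
have pg : polyseq (fun m => 'L_m(G)%G) i 0 g.
  have pX x : x \in 'L_i(G) -> polyseq (fun m => 'L_m(G)%G) i 0 (expgn x).
    exact: polyseq_expg.
  by apply: polyseqM (pX _ (groupM La Lb)) => //; [exact: lcnR |
    apply: polyseqM => //; try exact: lcnR; apply: polyseqV => //;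
    try exact: lcnR; exact: pX].
have g1 : g N = 1.
  rewrite (polyseq_expg_eq lcnB (@lcnR _ G) pg) //.
  - by rewrite /g !expg1 -invMg mulVg expg1n.
  - by rewrite /g !expg0 invg1 !mulg1.
by apply/eqP; rewrite eq_sym eq_mulVg1 invMg -/(g N) g1.
Qed.

(** The filtration step is [w], but the sequence [x^k, y] starts at level 1
    because y lies in L_1: so its j-th coefficient lies in L_(w j + 1) and not
    merely in L_(w j). This extra level is what makes the bound of
    [exponent_lcn] come out as stated. *)
Lemma expg_comm_lcn w N x y : x \in 'L_w(G) -> y \in G ->
    (forall j x, 1 < j -> x \in 'L_(w * j).+1(G) -> x ^+ 'C(N, j) = 1) ->
  [~ x ^+ N, y] = [~ x, y] ^+ N.
Proof.
move=> Lx Gy vanish; pose g k := [~ x ^+ k, y].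
have pg : polyseq (fun m => 'L_m(G)%G) w 1 g.
  rewrite -[1%N]add0n; apply: polyseqR => //; first exact: lcnR.
    exact: polyseq_expg.
  exact: polyseq_const.
by rewrite -/(g N) (polyseq_expg_eq lcnB (@lcnR _ G) pg) // /g expg0 comm1g.
Qed.

(** Descending induction on [w]. The j-th correction term lies in L_(w j + 1)
    and is raised to a power divisible by p^(n + l - f), f = v_p(j). Since
    j >= p^f, the hypothesis at (w, l) gives the one at (w j, l - f), so the
    induction hypothesis kills this power; if f > l the term itself is
    trivial. The same vanishing serves for the commutators [y, z] generating
    L_(w+1), whose N-th power is [y^N, z] = 1, and for their products. *)
Lemma exponent_lcn w l : 0 < w -> 'L_(w * p ^ l).+1(G) = 1 ->
  exponent 'L_w.+1(G) %| p ^ (n + l).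
Proof.
move=> w_gt0 Lwl; pose c := (w * p ^ l)%N.
have trivL i : c <= i -> 'L_i.+1(G) = 1.
  by move=> leci; apply/trivgP; rewrite -Lwl lcnB.
have [k] := ubnP (c - w); clearbody c.
elim: k => // k IHk in w l w_gt0 Lwl *; rewrite ltnS => le_k.
have [le_cw|lt_wc] := leqP c w; first by rewrite trivL // exponent1.
have vanish j x :
  1 < j -> x \in 'L_(w * j).+1(G) -> x ^+ 'C(p ^ (n + l), j) = 1.
- move=> j_gt1 Lx; have j_gt0 : 0 < j by apply: ltnW.
  have le_pj : p ^ logn p j <= j by apply: dvdn_leq; rewrite ?pfactor_dvdnn.
  have [lefl|ltlf] := leqP (logn p j) l; last first.
    have: x \in 'L_(w * p ^ l).+1(G).
      apply: subsetP (lcnB _) x Lx; rewrite ltnS leq_mul2l.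
      rewrite (leq_trans _ le_pj) ?orbT // leq_exp2l ?prime_gt1 //.
      exact: ltnW.
    by rewrite Lwl => /set1gP->; rewrite expg1n.
  apply/eqP; rewrite -order_dvdn.
  apply: dvdn_trans (dvdn_bin_expn _ pr_p j_gt0); rewrite -addnBA //.
  apply: dvdn_trans (dvdn_exponent Lx) _; apply: IHk.
  + by rewrite muln_gt0 w_gt0.
  + apply/trivgP; rewrite -Lwl lcnB // ltnS -mulnA leq_mul2l.
    by rewrite -(subnKC lefl) expnD addKn leq_mul2r le_pj !orbT.
  apply: leq_trans le_k; apply: ltn_sub2l => //.
  by rewrite -{1}(muln1 w) ltn_pmul2l.
(* L_(w+1) unfolds to [L_w, G] only for w visibly positive. *)
case: w => // w in w_gt0 Lwl lt_wc vanish le_k *.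
have gR : group_set [set x in 'L_w.+2(G) | x ^+ (p ^ (n + l)) == 1].
  apply/group_setP; split=> [|a b]; rewrite !inE.
    by rewrite expg1n eqxx group1.
  case/andP=> La /eqP aN /andP[Lb /eqP bN]; rewrite groupM //.
  rewrite (expg_mul_lcn La Lb) ?aN ?bN ?mulg1 ?eqxx // => j x j_gt1 Lx.
  apply: vanish (j_gt1) _; apply: subsetP (lcnB _) x Lx.
  by rewrite (mulSn w.+1) -add1n leq_add2r ltnW.
apply/exponentP=> x; suff sLR : 'L_w.+2(G) \subset group gR.
  by move/(subsetP sLR); rewrite inE => /andP[_ /eqP].
change ([~: 'L_w.+1(G), G] \subset group gR); rewrite gen_subG.
apply/subsetP=> _ /imset2P[y z Ly Gz ->].
have Lyz : [~ y, z] \in 'L_w.+2(G) by apply: mem_commg.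
rewrite inE Lyz -(expg_comm_lcn Ly Gz vanish) expnD mulnC expgM expZ ?eqxx //.
by rewrite groupX // (subsetP (lcn_sub _ _) y Ly).
Qed.

(** As L_2 is abelian, [y, z]^(p^n) = [y^(p^n), z] = 1 for y in L_2, so L_3 has
    exponent dividing p^n with no loss. In the expansion of [y^(p^(n+1)), z] the
    j-th term lies in L_3 and is raised to a multiple of p^(n + 1 - v_p(j)),
    which is enough when v_p(j) <= 1; otherwise j >= p^2 and L_(j+1) = 1. *)
Lemma exponent_der1_metabelian : abelian G^`(1) -> 'L_(p ^ 2).+1(G) = 1 ->
  exponent G^`(1) %| p ^ n.+1.
Proof.
rewrite -lcn2 => cL2 Lp2; have sL32 : 'L_3(G) \subset 'L_2(G) by apply: lcnB.
have eL3 : exponent 'L_3(G) %| p ^ n.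
  rewrite (_ : 'L_3(G) = <<commg_set 'L_2(G) G>>) // abelian_exponent_gen.
    apply/exponentP=> _ /imset2P[y z Ly Gz ->].
    have Lyz : [~ y, z] \in 'L_3(G) by apply: mem_commg.
    rewrite -commXg ?expZ // ?(subsetP (lcn_sub 2 G) y) //.
    exact: (centsP cL2) (subsetP sL32 _ Lyz).
  rewrite -abelian_gen; exact: abelianS sL32 cL2.
have vanish j x :
  1 < j -> x \in 'L_(1 * j).+1(G) -> x ^+ 'C(p ^ n.+1, j) = 1.
- rewrite mul1n => j_gt1 Lx; have j_gt0 : 0 < j by apply: ltnW.
  have le_pj : p ^ logn p j <= j by apply: dvdn_leq; rewrite ?pfactor_dvdnn.
  have [lej1|lt1j] := leqP (logn p j) 1; last first.
    have: x \in 'L_(p ^ 2).+1(G).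
      apply: subsetP (lcnB _) x Lx; rewrite ltnS (leq_trans _ le_pj) //.
      by rewrite (leq_exp2l _ _ (prime_gt1 pr_p)).
    by rewrite Lp2 => /set1gP->; rewrite expg1n.
  apply/eqP; rewrite -order_dvdn.
  apply: dvdn_trans (dvdn_bin_expn _ pr_p j_gt0).
  apply: dvdn_trans (dvdn_exponent (subsetP (lcnB _) x Lx)) _; last first.
    by apply: dvdn_trans eL3 _; rewrite dvdn_exp2l // -addn1 -addnBA ?leq_addr.
  exact: j_gt1.
rewrite (_ : 'L_2(G) = <<commg_set G G>>) // abelian_exponent_gen.
  apply/exponentP=> _ /imset2P[y z Gy Gz ->].
  by rewrite -(expg_comm_lcn _ Gz vanish) // expnS expgM expZ ?groupX.
by rewrite -abelian_gen.
Qed.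

End LowerCentralExponent.

(** * Automorphisms of a p-group *)

Section Automorphisms.

Variables (gT : finGroupType) (p : nat).
Variables (G : {group gT}) (S : {group {perm gT}}).
Hypotheses (pr_p : prime p) (pG : p.-group G) (sylS : p.-Sylow(Aut G) S).

Lemma expg_morph_in (rT : finGroupType) (f : gT -> rT) k x :
  {in G &, {morph f : x y / x * y}} -> x \in G -> f (x ^+ k) = f x ^+ k.
Proof.
move=> fM Gx; have f1 : f 1 = 1 by apply: (mulgI (f 1)); rewrite -fM ?mulg1.
by elim: k => // k IHk; rewrite !expgS fM ?groupX ?IHk.
Qed.

Lemma order_part_Aut a : a \in Aut G -> #[a]`_p %| exponent S.
Proof.
move=> Aa; rewrite -order_constt.
have Ac : <[a.`_p]> \subset Aut G by rewrite cycle_subG groupX.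
have [//|b Ab] := Sylow_Jsub sylS Ac; first exact: p_elt_constt.
by move/exponentS; rewrite exponentJ exponent_cycle.
Qed.

Lemma comm_expg_exponent x y :
  x \in G -> y \in G -> [~ x ^+ exponent S, y] = 1.
Proof.
move=> Gx Gy; have nGx : x \in 'N(G) by apply: (subsetP (normG G)).
have Aa : conj_aut G x \in Aut G.
  by apply: (subsetP (Aut_conj_aut G G)); apply: mem_morphim.
have aq : conj_aut G x ^+ exponent S = 1.
  apply/eqP; rewrite -order_dvdn; apply: dvdn_trans (order_part_Aut Aa).
  rewrite part_pnat_id ?dvdnn //; apply: mem_p_elt (morphim_pgroup _ pG) _.
  exact: mem_morphim.
apply/eqP/commgP/commute_sym/commgP/conjg_fixP.
rewrite -(conj_autE (G := G)) ?groupX //.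
by rewrite morphX // aq perm1.
Qed.

(** The automorphism is x |-> x f(x). It is injective because an x in its
    kernel is a power of t, on which it acts as raising to the power 1 + a with
    a divisible by p. Evaluating its power of exponent equal to its order at x0
    shows that the order of t divides a geometric sum of ratio 1 + a, hence the
    p-part of that order. *)
Lemma order_central_aut (f : gT -> gT) t x0 :
    {in G &, {morph f : x y / x * y}} -> t \in 'Z(G) ->
    {in G, forall x, f x \in <[t]>} -> x0 \in G -> f x0 = t ->
    f t \in <[t ^+ (p ^ 2)]> ->
  #[t] %| exponent S.
Proof.
move=> fM /centerP[Gt cGt] ft Gx0 fx0.
case/cycleP=> i; rewrite -expgM; set a := (p ^ 2 * i)%N => def_ft.
have pt : p.-elt t by apply: mem_p_elt pG Gt.
have cft x y : x \in G -> y \in G -> commute (f x) y.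
  by move=> /ft/cycleP[j ->] Gy; apply/commute_sym/commuteX/commute_sym/cGt.
have fX k x : x \in G -> f (x ^+ k) = f x ^+ k by apply: expg_morph_in.
have ff x : x \in G -> f (f x) = f x ^+ a.
  move=> Gx; have /cycleP[j ->] := ft x Gx.
  by rewrite fX // def_ft -!expgM mulnC.
have Gf x : x \in G -> f x \in G.
  by move/ft; apply: subsetP; rewrite cycle_subG.
pose h x := x * f x.
have hM : {in G &, {morph h : x y / x * y}}.
  move=> x y Gx Gy; rewrite /h fM // !mulgA; congr (_ * _).
  by rewrite -!mulgA; congr (_ * _); rewrite cft.
pose hm := Morphism hM.
have injh : 'injm hm.
  apply/subsetP=> x /morphpreP[Gx /set1P]; rewrite /= /h => hx1.
  have def_x : x = (f x)^-1 by apply/eqP; rewrite eq_mulgV1 invgK hx1.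
  have /cycleP[j def_fx] := ft x Gx.
  have: f x * f (f x) = 1 by rewrite -fM ?Gf // hx1 (fX 0 1).
  rewrite ff // -expgS def_fx -expgM => /eqP; rewrite -order_dvdn.
  have co : coprime #[t] a.+1.
    have [r ->] := p_natP pt; rewrite coprimeXl // prime_coprime //.
    rewrite -addn1 dvdn_addr; last by rewrite dvdn_mulr ?dvdn_exp.
    by rewrite dvdn1 gtn_eqF ?prime_gt1.
  rewrite Gauss_dvdl // order_dvdn => /eqP tj1.
  by rewrite def_x def_fx tj1 invg1 inE.
have imh : hm @* G = G.
  apply/eqP; rewrite eqEcard card_injm ?leqnn // andbT morphimEdom.
  by apply/subsetP=> _ /imsetP[x Gx ->]; rewrite /= groupM ?Gf.
pose al := aut injh imh.
have alE x : x \in G -> al x = x * f x by move=> Gx; rewrite [al x]autE.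
have alX N x : x \in G -> (al ^+ N) x = x * f x ^+ \sum_(j < N) a.+1 ^ j.
  move=> Gx; elim: N => [|N IHN]; first by rewrite perm1 big_ord0 mulg1.
  rewrite expgSr permM IHN alE; last by rewrite groupM ?groupX ?Gf.
  rewrite fM ?groupX ?Gf // fX ?Gf // ff // -!mulgA; congr (_ * _).
  rewrite -expgM -expgS -expgD; congr (_ ^+ _).
  rewrite big_ord_recl expn0 big_distrr /=.
  rewrite addnS add1n -big_split; congr _.+1.
  by apply: eq_bigr => j _; rewrite expnS mulSn.
have Aal : al \in Aut G by apply: Aut_aut.
apply: dvdn_trans (order_part_Aut Aal).
have : #[t] %| \sum_(j < #[al]) a.+1 ^ j.
  rewrite order_dvdn -fx0; apply/eqP/(mulgI x0).
  by rewrite -alX // expg_order perm1 mulg1.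
have [r ->] := p_natP pt.
move/(dvdn_geometric_sum pr_p (dvdn_mulr i (dvdnn _)) (order_gt0 al)).
by rewrite pfactor_dvdn ?order_gt0 // p_part => ?; rewrite dvdn_exp2l.
Qed.

Lemma cyclic_quotient_fun (rT : finGroupType) (M : {group gT}) (z : rT) :
    M <| G -> cyclic (G / M) -> #[z] %| #|G / M| ->
  exists f : gT -> rT,
    [/\ {in G &, {morph f : x y / x * y}}, {in G, forall x, f x \in <[z]>},
        {in M, forall x, f x = 1} & exists2 x0, x0 \in G & f x0 = z].
Proof.
move=> /andP[sMG nMG] /cyclicP[u def_u]; rewrite def_u -orderE => dvd_zu.
have Gu x : x \in G -> coset M x \in <[u]>.
  by move=> Gx; rewrite -def_u mem_quotient.
exists (fun x => eltm dvd_zu (coset M x)); split.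
- move=> x y Gx Gy; rewrite morphM ?(subsetP nMG) // morphM ?Gu //.
- by move=> x Gx; rewrite -(im_eltm dvd_zu) mem_morphim ?Gu.
- by move=> x Mx; rewrite coset_id // morph1.
have /morphimP[x0 _ Gx0 def_x0] : u \in G / M by rewrite def_u cycle_id.
by exists x0 => //; rewrite -def_x0 eltm_id.
Qed.

(** A cyclic subgroup of maximal order splits off the abelian group G/G'. *)
Lemma cyclic_quotient_der1 : exists M : {group gT},
  [/\ M <| G, cyclic (G / M) & #|G / M| = exponent (G / G^`(1))].
Proof.
have cA : abelian (G / G^`(1)) := der_abelian 0 G.
have [x Ax ox] := exponent_witness (abelian_nil cA).
have /splitsP[K /complP[tiK defA]] := abelian_splits Ax (esym ox) cA.
have sKA : K \subset G / G^`(1) by rewrite -defA mulG_subr.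
have sxA : <[x]> \subset G / G^`(1) by rewrite cycle_subG.
have nKA : K <| G / G^`(1) by rewrite -sub_abelian_normal.
have [M defK sGM nMG] := inv_quotientN (der_normal 1 G) nKA.
have iso : G / M \isog <[x]>.
  have iso1 : (G / G^`(1)) / K \isog G / M.
    by rewrite defK; exact: third_isog sGM (der_normal 1 G) nMG.
  apply: isog_trans (isog_symr iso1) _; rewrite isog_sym.
  apply: sdprod_isog; rewrite sdprodE ?[K :&: _]setIC //.
    rewrite -defA; apply/esym/normC.
    exact: subset_trans sxA (normal_norm nKA).
  exact: subset_trans sxA (normal_norm nKA).
exists M; split=> //; first by rewrite (isog_cyclic iso) cycle_cyclic.
by rewrite (card_isog iso) ox.
Qed.

(** Take t central of order p and a normal subgroup M of index p containing t,
    which exists since |G| > p; a homomorphism from G onto <t> with kernel M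
    satisfies f(t) = 1. *)
Lemma prime_dvd_exponent : p < #|G| -> p %| exponent S.
Proof.
move=> ltpG; have ntG : G :!=: 1.
  by rewrite -cardG_gt1 (leq_trans _ ltpG) // ltnS prime_gt0.
have ntZ : 'Z(G) != 1 by apply: contraNneq ntG => /(trivg_center_pgroup pG)->.
have pZ : p.-group 'Z(G) := pgroupS (center_sub G) pG.
have [_ /(Cauchy pr_p)[t Zt ot] _] := pgroup_pdiv pZ ntZ.
have Gt := subsetP (center_sub G) t Zt.
have nTG : <[t]> <| G by apply: sub_center_normal; rewrite cycle_subG.
have pQ : p.-group (G / <[t]>) by apply: quotient_pgroup.
have ntQ : G / <[t]> != 1.
  rewrite -subG1 quotient_sub1 ?normal_norm //; apply/negP=> /subset_leq_card.
  by rewrite -orderE ot leqNgt ltpG.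
have [_ _ [m oQ]] := pgroup_pdiv pQ ntQ.
have le_m : m <= logn p #|G / <[t]>| by rewrite oQ pfactorK.
have [R [_ nRQ oR]] := normal_pgroup pQ (normal_refl _) le_m.
have [M defR sTM nMG] := inv_quotientN nTG nRQ.
have oGM : #|G / M| = p.
  rewrite -(card_isog (third_isog sTM nTG nMG)) -defR.
  rewrite card_quotient ?normal_norm // -divgS ?normal_sub // oQ oR.
  by rewrite expnSr mulKn // expn_gt0 prime_gt0.
have cGM : cyclic (G / M) by rewrite prime_cyclic ?oGM.
have dvd_t : #[t] %| #|G / M| by rewrite ot oGM.
have [f [fM ft f1 [x0 Gx0 fx0]]] := cyclic_quotient_fun nMG cGM dvd_t.
rewrite -ot; apply: order_central_aut fM Zt ft Gx0 fx0 _.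
by rewrite f1 ?group1 // (subsetP sTM) ?cycle_id.
Qed.

(** Let f map G onto <z>, and apply [order_central_aut] to t = z^d and the
    homomorphism x |-> f(x)^d. With t = w^(e d) and f(w) a power of z = w^e,
    the image of t is a power of t^(d e), whence the condition on d e. *)
Lemma exponent_central z w d e : w \in 'Z(G) -> z = w ^+ e ->
  p ^ 2 %| d * e -> #[z] %| exponent (G / G^`(1)) -> #[z] %| d * exponent S.
Proof.
move=> Zw def_z dvd_de; have [M [nMG cGM <-]] := cyclic_quotient_der1.
case/(cyclic_quotient_fun nMG cGM) => f [fM fz _ [x0 Gx0 fx0]].
have Zz : z \in 'Z(G) by rewrite def_z groupX.
have Gw := subsetP (center_sub G) w Zw; have Gz := subsetP (center_sub G) z Zz.
have fX k x : x \in G -> f (x ^+ k) = f x ^+ k by apply: expg_morph_in.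
have dvd_d : #[z ^+ d] %| exponent S.
  apply: (@order_central_aut (fun x => f x ^+ d) _ x0) => //.
  - move=> x y Gx Gy; rewrite fM // expgMn //.
    by apply: (centsP (cycle_abelian z)); apply: fz.
  - by rewrite groupX.
  - by move=> x /fz/cycleP[j ->]; rewrite -expgM mulnC expgM mem_cycle.
  - by rewrite fx0.
  have /cycleP[j def_fw] := fz w Gw; have /dvdnP[k def_k] := dvd_de.
  rewrite def_z -expgM fX // def_fw -!expgM; apply/cycleP.
  exists (j * k)%N; rewrite def_z -!expgM; congr (_ ^+ _).
  rewrite (mulnACA (e * d)%N) (mulnC (p ^ 2)%N) -def_k -!mulnA; congr muln.
  by rewrite (mulnCA d) (mulnA d d e) (mulnC (d * d)%N).
by rewrite order_dvdn expgM -order_dvdn.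
Qed.

(** If exp(Z) divides exp(G/G'), take for z an element of maximal order of Z,
    with w = z and d = p^2. Otherwise Z has an element w of order
    p exp(G/G'), and z = w^p is itself a p-th power in Z, so d = p is enough;
    this saved factor p is needed since in this case exp(G/G') is
    multiplied by the bound on exp(G'). *)
Lemma exponent_center_or_der1 :
  exponent 'Z(G) %| p ^ 2 * exponent S
    \/ exponent (G / G^`(1)) %| p * exponent S.
Proof.
have pZ : p.-group 'Z(G) := pgroupS (center_sub G) pG.
have pQ : p.-group (G / G^`(1)) by apply: quotient_pgroup.
have [z Zz ez] := exponent_witness (pgroup_nil pZ).
have [k ek] := p_natP (etrans (pnat_exponent _ _) pQ).
have [dvd_ZQ | ndvd] := boolP (exponent 'Z(G) %| exponent (G / G^`(1))).
  left; rewrite ez in dvd_ZQ *.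
  by apply: (@exponent_central z z (p ^ 2) 1) => //; rewrite muln1.
right; rewrite ek; have [m em] := p_natP (etrans (pnat_exponent _ _) pZ).
have ltkm : k < m by rewrite ltnNge -(dvdn_Pexp2l _ _ (prime_gt1 pr_p)) -ek -em.
pose w := z ^+ (p ^ (m - k.+1)).
have ow : #[w] = (p ^ k.+1)%N.
  rewrite orderXdiv -ez em ?dvdn_exp2l ?leq_subr //.
  by rewrite -expnB ?prime_gt0 ?leq_subr // subKn.
have owp : #[w ^+ p] = (p ^ k)%N.
  by rewrite orderXdiv ow expnS ?dvdn_mulr // mulKn ?prime_gt0.
rewrite -owp; apply: (@exponent_central _ w p p) => //.
- by rewrite groupX.
by rewrite owp -ek.
Qed.

End Automorphisms.

Theorem theorem3p5 (p : nat) (gT : finGroupType) (G : {group gT})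
    (S : {group {perm gT}}) (q : nat) :
  prime p ->
  (p.-group G)%g ->
  (p.-Sylow(Aut G) S)%g ->
  exponent S = q ->
  (metabelian G -> nil_class G <= 2 * p - 1 ->
     exponent G %| p * q ^ 3)
  /\
  (forall c : nat, nil_class G = c -> #|G| != p ->
     exponent G %| p ^ up_log p c * q ^ 3).
Proof.
move=> pr_p pG sylS eSq; have nilG := pgroup_nil pG.
have [ltGp | ltpG | oG] := ltngtP #|G| p; last 1 first.
- split=> [_ _|c _] //.
  by apply: dvdn_trans (exponent_dvdn G) _; rewrite oG dvdn_mulr.
- have ->: G = 1%G; last by rewrite exponent1; split=> *; rewrite dvd1n.
  apply/val_inj/eqP; rewrite /= trivg_card1.
  have [r oG] := p_natP pG; move: ltGp; rewrite oG.
  by case: r {oG} => // r; rewrite expnS ltnNge leq_pmulr // expn_gt0 prime_gt0.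
have dvd_pq : p %| q by rewrite -eSq; apply: prime_dvd_exponent sylS ltpG.
have [n eq_q] : exists n, q = (p ^ n)%N.
  have: p.-nat q by rewrite -eSq pnat_exponent (pHall_pgroup sylS).
  by case/p_natP=> n ->; exists n.
have expZ x y : x \in G -> y \in G -> [~ x ^+ (p ^ n), y] = 1.
  by rewrite -eq_q -eSq; apply: comm_expg_exponent pG sylS _ _.
have dvd_Z : exponent G %| exponent 'Z(G) * q.
  apply/exponentP=> x Gx; rewrite mulnC expgM expg_exponent //.
  apply/centerP; split=> [|y Gy]; first exact: groupX.
  by apply/commgP; rewrite eq_q expZ.
have dvd_der : exponent G %| exponent (G / G^`(1)) * exponent G^`(1).
  apply/exponentP=> x Gx; rewrite expgM; apply: expg_exponent.
  have nGx := subsetP (normal_norm (der_normal 1 G)) x Gx.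
  by apply: coset_idr; rewrite ?groupX // morphX // expg_exponent ?mem_quotient.
have [expZq | expQq] := exponent_center_or_der1 pr_p pG sylS.
  (* exp(G) divides q exp(Z), so p^2 q^2; one factor p is absorbed by q. *)
  rewrite eSq in expZq.
  have dvd_G : exponent G %| p * q ^ 3.
    apply: dvdn_trans dvd_Z _; rewrite expnSr mulnA dvdn_pmul2r //.
      apply: dvdn_trans expZq _; rewrite -!mulnn -!mulnA.
      by rewrite dvdn_mul // dvdn_mul.
    by rewrite eq_q expn_gt0 prime_gt0.
  split=> // c cG _; have [le_c1 | lt1c] := leqP c 1.
    have /center_idP cGG : abelian G by rewrite -nil_class1 cG.
    move: expZq; rewrite cGG => /dvdn_trans->//.
    by rewrite dvdn_mull // (expnSr q 2) dvdn_mul // dvdn_exp2r.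
  apply: dvdn_trans dvd_G _; rewrite dvdn_mul //.
  by rewrite dvdn_exp // up_log_gt0 prime_gt1.
rewrite eSq in expQq.
have bound m : exponent G^`(1) %| m * q -> exponent G %| m * q ^ 3.
  move=> dvd_m; apply: dvdn_trans dvd_der _.
  apply: dvdn_trans (dvdn_mul expQq dvd_m) _.
  by rewrite mulnC -mulnA dvdn_mul // mulnCA !expnS expn0 muln1 dvdn_mul.
have Lnil l : nil_class G <= l -> 'L_l.+1(G) = 1 by move/lcn_nil_classP; apply.
split=> [abG' le_c | c cG _]; apply: bound.
  rewrite eq_q -expnS; apply: exponent_der1_metabelian => //.
  apply: Lnil; apply: leq_trans le_c (leq_trans (leq_subr 1 _) _).
  by rewrite -mulnn leq_mul2r prime_gt1 ?orbT.
rewrite eq_q -expnD addnC -[G^`(1)]lcn2; apply: exponent_lcn => //.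
by apply: Lnil; rewrite mul1n cG up_logP ?prime_gt1.
Qed.
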